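(* Let $I\subseteq\mathbb{R}$ be an open interval, $s_0\in I$, and let $\alpha:I\to\mathbb{R}^3$ be a curve parametrized by arc length $s$, with curvature $\kappa=\kappa(s)>0$ and torsion $\tau=\tau(s)\neq0$ for all $s\in I$, where $\kappa$ and $\tau$ are continuously differentiable functions. Then $\alpha$ is a whirl curve if and only if there exist real constants $\lambda\neq0$ and $B$ with $\lambda\int_{s_0}^s\kappa(r)\,dr<B$ for all $s\in I$ such that, writing $E(s)=e^{\lambda\int_{s_0}^s\kappa(r)\,dr-B}$, the position vector of $\alpha$ is, up to a rigid motion of $\mathbb{R}^3$, of the form $\alpha(s)=(x(s),y(s),z(s))$ with $$x(s)=\int\sqrt{1-\frac{E(s)^2}{1+\lambda^2}}\;\cos\!\left(\arctan\!\left[\frac{\sqrt{1-E(s)^2}}{\lambda}\right]-\frac{\operatorname{arctanh}\!\left[\sqrt{1-E(s)^2}\right]}{\lambda}\right)ds,$$ $$y(s)=\int\sqrt{1-\frac{E(s)^2}{1+\lambda^2}}\;\sin\!\left(\arctan\!\left[\frac{\sqrt{1-E(s)^2}}{\lambda}\right]-\frac{\operatorname{arctanh}\!\left[\sqrt{1-E(s)^2}\right]}{\lambda}\right)ds,$$ $$z(s)=\pm\int\frac{E(s)}{\sqrt{1+\lambda^2}}\,ds,$$ for one of the two choices of the sign $\pm$ (the same for all $s\in I$).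
   Context: For a unit speed curve $\alpha$ with positive curvature, $\{\mathbf{t},\mathbf{n},\mathbf{b}\}$ denotes its Frenet frame (tangent, normal, binormal), with Frenet equations $\mathbf{t}'=\kappa\mathbf{n}$, $\mathbf{n}'=-\kappa\mathbf{t}+\tau\mathbf{b}$, $\mathbf{b}'=-\tau\mathbf{n}$ (the curve is assumed smooth enough for the frame and these equations to exist). A whirl curve is a curve with curvature $\kappa>0$ and nowhere vanishing torsion $\tau$ such that there exist a constant unit vector $\mathbf{d}\in\mathbb{R}^3$ and a real constant $\lambda\neq0$ with $\langle\mathbf{n}(s),\mathbf{d}\rangle=\lambda\langle\mathbf{t}(s),\mathbf{d}\rangle$ for all $s$. Indefinite integrals denote antiderivatives on $I$; the choice of integration constants is immaterial since it amounts to a translation. A rigid motion is an orientation-preserving isometry of $\mathbb{R}^3$. *)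

(* Defs.v *)
From Stdlib Require Export Reals.
From Coquelicot Require Export Coquelicot.

Open Scope R_scope.

(** * Euclidean three-space *)

Definition vec : Type := (R * R * R)%type.

Definition vx (v : vec) : R := fst (fst v).
Definition vy (v : vec) : R := snd (fst v).
Definition vz (v : vec) : R := snd v.

Definition vadd (u v : vec) : vec := (vx u + vx v, vy u + vy v, vz u + vz v).
Definition vsub (u v : vec) : vec := (vx u - vx v, vy u - vy v, vz u - vz v).
Definition vscal (c : R) (v : vec) : vec := (c * vx v, c * vy v, c * vz v).

Definition dot (u v : vec) : R := vx u * vx v + vy u * vy v + vz u * vz v.
Definition vnorm (v : vec) : R := sqrt (dot v v).

Definition cross (u v : vec) : vec :=
  (vy u * vz v - vz u * vy v,
   vz u * vx v - vx u * vz v,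
   vx u * vy v - vy u * vx v).

(* The determinant of the matrix with rows [u], [v], [w]. *)
Definition triple (u v w : vec) : R := dot (cross u v) w.

Definition isometry (f : vec -> vec) : Prop :=
  forall p q : vec, vnorm (vsub (f p) (f q)) = vnorm (vsub p q).

(* [f] maps every positively oriented triple of vectors issuing from a point
   to a positively oriented one. *)
Definition orientation_preserving (f : vec -> vec) : Prop :=
  forall p u v w : vec, 0 < triple u v w ->
    0 < triple (vsub (f (vadd p u)) (f p))
               (vsub (f (vadd p v)) (f p))
               (vsub (f (vadd p w)) (f p)).

Definition rigid_motion (f : vec -> vec) : Prop :=
  isometry f /\ orientation_preserving f.

(** * Curves and the Frenet frame *)

(* Curves on an open interval are total functions on [R]: every notion below is
   local, and is only ever asserted at points of the interval, so the values
   outside it are irrelevant. *)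

Definition in_interval (a b : Rbar) (s : R) : Prop :=
  Rbar_lt a s /\ Rbar_lt s b.

Definition C1_on (D : R -> Prop) (f : R -> R) : Prop :=
  forall s : R, D s -> ex_derive f s /\ continuous (Derive f) s.

Definition ex_vderive (f : R -> vec) (s : R) : Prop :=
  ex_derive (fun r => vx (f r)) s /\
  ex_derive (fun r => vy (f r)) s /\
  ex_derive (fun r => vz (f r)) s.

Definition vderive (f : R -> vec) (s : R) : vec :=
  (Derive (fun r => vx (f r)) s,
   Derive (fun r => vy (f r)) s,
   Derive (fun r => vz (f r)) s).

Definition tangent (alpha : R -> vec) : R -> vec := vderive alpha.

Definition curvature (alpha : R -> vec) (s : R) : R :=
  vnorm (vderive (tangent alpha) s).

Definition normal (alpha : R -> vec) (s : R) : vec :=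
  vscal (/ curvature alpha s) (vderive (tangent alpha) s).

Definition binormal (alpha : R -> vec) (s : R) : vec :=
  cross (tangent alpha s) (normal alpha s).

(* Sign convention b' = - tau n. *)
Definition torsion (alpha : R -> vec) (s : R) : R :=
  - dot (vderive (binormal alpha) s) (normal alpha s).

(* Three derivatives are what it takes, where the curvature is positive, for the
   frame to exist and be differentiable, that is, for the Frenet equations. *)
Definition arclength_curve (D : R -> Prop) (alpha : R -> vec) : Prop :=
  forall s : R, D s ->
    ex_vderive alpha s /\
    ex_vderive (vderive alpha) s /\
    ex_vderive (vderive (vderive alpha)) s /\
    vnorm (tangent alpha s) = 1.

Definition whirl_curve (D : R -> Prop) (alpha : R -> vec) : Prop :=
  arclength_curve D alpha /\
  (forall s : R, D s -> 0 < curvature alpha s) /\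
  (forall s : R, D s -> torsion alpha s <> 0) /\
  exists (d : vec) (lambda : R),
    vnorm d = 1 /\ lambda <> 0 /\
    forall s : R, D s ->
      dot (normal alpha s) d = lambda * dot (tangent alpha s) d.

(** * The position vector *)

Definition antiderivative_on (D : R -> Prop) (f F : R -> R) : Prop :=
  forall s : R, D s -> is_derive F s (f s).

(* The inverse hyperbolic tangent, for -1 < x < 1. *)
Definition arctanh (x : R) : R := / 2 * ln ((1 + x) / (1 - x)).

Definition whirl_E (kappa : R -> R) (s0 lambda B s : R) : R :=
  exp (lambda * RInt kappa s0 s - B).

Definition whirl_speed (lambda E : R) : R :=
  sqrt (1 - E ^ 2 / (1 + lambda ^ 2)).

Definition whirl_angle (lambda E : R) : R :=
  atan (sqrt (1 - E ^ 2) / lambda) - arctanh (sqrt (1 - E ^ 2)) / lambda.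

(* Main.v *)
Require Import Defs.
From Stdlib Require Import Lra Psatz.
Open Scope R_scope.

(** Let [u], [w] be the components of [t] and [b] along the axis [d]. Comparing
    the two expressions for the derivative of [<n, d> = lambda u] gives
    [(1 + lambda^2) kappa u = tau w], and [d] being a unit vector gives
    [(1 + lambda^2) u^2 + w^2 = 1]; so [u] and [w] vanish nowhere, and
    [u' = lambda kappa u] makes [u] proportional to [E]. Replacing [d] by [- d]
    makes [w] positive, hence [w = sqrt (1 - E^2)]. The unit vector in the
    direction of [t - u d] then turns around [d] with angular velocity
    [kappa w / (1 - u^2)], which is the derivative of
    [atan (w / lambda) - arctanh w / lambda]; undoing this rotation yields a
    constant orthonormal frame in which [t] has the stated components.
    Conversely, the image of the third axis under the linear part of the motion
    is an axis: [<t, d>] is then a multiple of [E], and one differentiates it. *)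

(** * Vector algebra in three-space *)

Lemma vec_ext (u v : vec) : vx u = vx v -> vy u = vy v -> vz u = vz v -> u = v.
Proof.
destruct u as [[u1 u2] u3], v as [[v1 v2] v3]; simpl.
now unfold vx, vy, vz; simpl; intros -> -> ->.
Qed.

Ltac vec_ring :=
  repeat match goal with v : vec |- _ => destruct v as [[? ?] ?] end;
  try apply vec_ext;
  unfold triple, vadd, vsub, vscal, cross, dot, vx, vy, vz; simpl; ring.

Lemma dot_comm (u v : vec) : dot u v = dot v u.
Proof. vec_ring. Qed.

Lemma dot_addr (u v w : vec) : dot u (vadd v w) = dot u v + dot u w.
Proof. vec_ring. Qed.

Lemma dot_addl (u v w : vec) : dot (vadd u v) w = dot u w + dot v w.
Proof. vec_ring. Qed.

Lemma dot_scalr (c : R) (u v : vec) : dot u (vscal c v) = c * dot u v.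
Proof. vec_ring. Qed.

Lemma dot_scall (c : R) (u v : vec) : dot (vscal c u) v = c * dot u v.
Proof. vec_ring. Qed.

Lemma dot_cross_l (u v : vec) : dot (cross u v) u = 0.
Proof. vec_ring. Qed.

Lemma dot_cross_r (u v : vec) : dot (cross u v) v = 0.
Proof. vec_ring. Qed.

Lemma dot_cross_self (u v : vec) :
  dot (cross u v) (cross u v) = dot u u * dot v v - dot u v ^ 2.
Proof. vec_ring. Qed.

Lemma dot_nonneg (u : vec) : 0 <= dot u u.
Proof. unfold dot; nra. Qed.

Lemma vnorm_1 (u : vec) : vnorm u = 1 <-> dot u u = 1.
Proof.
unfold vnorm; split; intros h.
- rewrite <- (sqrt_sqrt (dot u u)), h; [ring | apply dot_nonneg].
- rewrite h; apply sqrt_1.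
Qed.

Lemma vnorm_eq (u v : vec) : vnorm u = vnorm v <-> dot u u = dot v v.
Proof.
unfold vnorm; split; intros h.
- apply sqrt_inj; [apply dot_nonneg | apply dot_nonneg | exact h].
- now rewrite h.
Qed.

(** The identity [h] is Cramer's rule for [t], [n], [t x n] with its denominator cleared, so it
    holds for arbitrary vectors; orthonormality then reduces the Gram coefficients to 0 and 1. *)
Lemma orthonormal_expand (t n v : vec) :
  dot t t = 1 -> dot n n = 1 -> dot t n = 0 ->
  v = vadd (vadd (vscal (dot v t) t) (vscal (dot v n) n))
           (vscal (dot v (cross t n)) (cross t n)).
Proof.
intros ht hn htn.
assert (hb : dot (cross t n) (cross t n) = 1).
{ rewrite dot_cross_self, ht, hn, htn; ring. }
assert (h : vscal (dot (cross t n) (cross t n)) v =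
  vadd (vadd (vscal (dot v (vsub (vscal (dot n n) t) (vscal (dot t n) n))) t)
             (vscal (dot v (vsub (vscal (dot t t) n) (vscal (dot t n) t))) n))
       (vscal (dot v (cross t n)) (cross t n))) by vec_ring.
rewrite hb, ht, hn, htn in h.
transitivity (vscal 1 v); [vec_ring |].
rewrite h; clear; vec_ring.
Qed.

Lemma vscal_1 (v : vec) : vscal 1 v = v.
Proof. vec_ring. Qed.

Lemma vscal_mul (c k : R) (v : vec) : vscal c (vscal k v) = vscal (c * k) v.
Proof. vec_ring. Qed.

(** * Derivatives of vector-valued functions *)

Definition is_vderive (f : R -> vec) (s : R) (v : vec) : Prop :=
  is_derive (fun r => vx (f r)) s (vx v) /\
  is_derive (fun r => vy (f r)) s (vy v) /\
  is_derive (fun r => vz (f r)) s (vz v).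

Lemma is_derive_eq (f : R -> R) (s l l' : R) :
  is_derive f s l' -> l' = l -> is_derive f s l.
Proof. now intros h <-. Qed.

Lemma is_derive_Rmult (f g : R -> R) (s df dg : R) :
  is_derive f s df -> is_derive g s dg ->
  is_derive (fun r => f r * g r) s (df * g s + f s * dg).
Proof. intros hf hg; apply (is_derive_mult f g s df dg hf hg Rmult_comm). Qed.

Lemma is_derive_Rplus (f g : R -> R) (s df dg : R) :
  is_derive f s df -> is_derive g s dg ->
  is_derive (fun r => f r + g r) s (df + dg).
Proof. intros hf hg; apply (is_derive_plus f g s df dg hf hg). Qed.

Lemma is_derive_Rminus (f g : R -> R) (s df dg : R) :
  is_derive f s df -> is_derive g s dg ->
  is_derive (fun r => f r - g r) s (df - dg).
Proof. intros hf hg; apply (is_derive_minus f g s df dg hf hg). Qed.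

Lemma vderive_correct (f : R -> vec) (s : R) :
  ex_vderive f s -> is_vderive f s (vderive f s).
Proof.
now intros (hx & hy & hz); split; [| split]; apply Derive_correct.
Qed.

Lemma is_vderive_unique (f : R -> vec) (s : R) (v : vec) :
  is_vderive f s v -> vderive f s = v.
Proof.
intros (hx & hy & hz).
now apply vec_ext; apply is_derive_unique.
Qed.

Lemma is_vderive_eq (f : R -> vec) (s : R) (v v' : vec) :
  is_vderive f s v' -> v' = v -> is_vderive f s v.
Proof. now intros h <-. Qed.

Lemma is_vderive_const (v : vec) (s : R) : is_vderive (fun _ => v) s (0, 0, 0).
Proof. split; [| split]; apply (is_derive_const (K := R_AbsRing) (V := R_NormedModule)). Qed.

Lemma is_vderive_sub (f g : R -> vec) (s : R) (df dg : vec) :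
  is_vderive f s df -> is_vderive g s dg ->
  is_vderive (fun r => vsub (f r) (g r)) s (vsub df dg).
Proof.
intros (f1 & f2 & f3) (g1 & g2 & g3).
split; [| split]; now apply is_derive_Rminus.
Qed.

Lemma is_vderive_scal (c : R -> R) (f : R -> vec) (s dc : R) (df : vec) :
  is_derive c s dc -> is_vderive f s df ->
  is_vderive (fun r => vscal (c r) (f r)) s
    (vadd (vscal dc (f s)) (vscal (c s) df)).
Proof.
intros hc (f1 & f2 & f3).
split; [| split]; now apply is_derive_Rmult.
Qed.

Lemma is_vderive_cross (f g : R -> vec) (s : R) (df dg : vec) :
  is_vderive f s df -> is_vderive g s dg ->
  is_vderive (fun r => cross (f r) (g r)) s
    (vadd (cross df (g s)) (cross (f s) dg)).
Proof.
intros (f1 & f2 & f3) (g1 & g2 & g3).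
split; [| split]; simpl;
  (eapply is_derive_eq;
   [apply is_derive_Rminus; apply is_derive_Rmult; eassumption |]);
  unfold cross, vadd, vx, vy, vz; simpl; ring.
Qed.

Lemma is_derive_dot (f g : R -> vec) (s : R) (df dg : vec) :
  is_vderive f s df -> is_vderive g s dg ->
  is_derive (fun r => dot (f r) (g r)) s (dot df (g s) + dot (f s) dg).
Proof.
intros (f1 & f2 & f3) (g1 & g2 & g3).
unfold dot; eapply is_derive_eq;
  [apply is_derive_Rplus; [apply is_derive_Rplus |];
   apply is_derive_Rmult; eassumption | simpl; ring].
Qed.

Lemma is_derive_dot_const (f : R -> vec) (d : vec) (s : R) (df : vec) :
  is_vderive f s df -> is_derive (fun r => dot (f r) d) s (dot df d).
Proof.
intros hf; eapply is_derive_eq;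
  [apply is_derive_dot; [exact hf | apply is_vderive_const] |].
vec_ring.
Qed.

(** * Constancy and sign on an open interval *)

Lemma in_interval_locally (a b : Rbar) (s : R) :
  in_interval a b s -> locally s (in_interval a b).
Proof.
intros [ha hb].
destruct (Rbar_lt_locally a b s ha hb) as [e he].
exists e; intros y hy; apply he, hy.
Qed.

Lemma in_interval_between (a b : Rbar) (s s' r : R) :
  in_interval a b s -> in_interval a b s' -> s <= r <= s' -> in_interval a b r.
Proof.
intros [h1 h2] [h3 h4] [h5 h6]; split.
- now apply Rbar_lt_le_trans with s.
- now apply Rbar_le_lt_trans with s'.
Qed.

Lemma derive_zero_const (a b : Rbar) (f : R -> R) :
  (forall r, in_interval a b r -> is_derive f r 0) ->
  forall s s', in_interval a b s -> in_interval a b s' -> f s = f s'.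
Proof.
intros hf.
assert (h : forall s s', in_interval a b s -> in_interval a b s' -> s < s' -> f s = f s').
{ intros s s' hs hs' hlt.
  apply (eq_is_derive (V := R_NormedModule) f s s'); [| exact hlt].
  intros r hr; apply hf; exact (in_interval_between a b s s' r hs hs' hr). }
intros s s' hs hs'; destruct (Rtotal_order s s') as [hlt | [-> | hgt]].
- now apply h.
- reflexivity.
- symmetry; now apply h.
Qed.

Lemma vderive_zero_const (a b : Rbar) (f : R -> vec) :
  (forall r, in_interval a b r -> is_vderive f r (0, 0, 0)) ->
  forall s s', in_interval a b s -> in_interval a b s' -> f s = f s'.
Proof.
intros hf s s' hs hs'.
apply vec_ext.
- apply (derive_zero_const a b (fun r => vx (f r))); trivial; intros r hr; apply (hf r hr).
- apply (derive_zero_const a b (fun r => vy (f r))); trivial; intros r hr; apply (hf r hr).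
- apply (derive_zero_const a b (fun r => vz (f r))); trivial; intros r hr; apply (hf r hr).
Qed.

Lemma is_derive_local (a b : Rbar) (f g : R -> R) (s l : R) :
  in_interval a b s -> (forall r, in_interval a b r -> f r = g r) ->
  is_derive f s l -> is_derive g s l.
Proof.
intros hs hfg; apply is_derive_ext_loc.
now apply (filter_imp (in_interval a b)); [| apply in_interval_locally].
Qed.

Lemma nonvanishing_same_sign (a b : Rbar) (f : R -> R) :
  (forall r, in_interval a b r -> ex_derive f r /\ f r <> 0) ->
  forall s s', in_interval a b s -> in_interval a b s' -> 0 < f s * f s'.
Proof.
intros hf s s' hs hs'.
assert (hpos : forall r, in_interval a b r -> 0 < sqrt (f r ^ 2)).
{ intros r hr; apply sqrt_lt_R0; destruct (hf r hr) as [_ h]; nra. }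
(* The sign of [f], written as [f / |f|], is locally constant. *)
assert (hc : f s / sqrt (f s ^ 2) = f s' / sqrt (f s' ^ 2)).
{ apply (derive_zero_const a b (fun r => f r / sqrt (f r ^ 2))); trivial.
  intros r hr; destruct (hf r hr) as [hd h0].
  specialize (hpos r hr).
  assert (hsq : sqrt (f r ^ 2) * sqrt (f r ^ 2) = f r ^ 2)
    by (apply sqrt_sqrt; nra).
  auto_derive; simpl in *.
  - repeat split; trivial; nra.
  - rewrite Rmult_1_r in *.
    set (q := sqrt (f r * f r)) in *.
    rewrite hsq; replace (/ q) with (q / (f r * f r)) by (rewrite <- hsq; field; lra).
    replace (/ (2 * q)) with (q / (2 * (f r * f r))) by (rewrite <- hsq; field; lra).
    field; exact h0. }
specialize (hpos s hs) as h1; specialize (hpos s' hs') as h2.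
destruct (hf s hs) as [_ h0]; destruct (hf s' hs') as [_ h0'].
assert (h : f s = f s' * (sqrt (f s ^ 2) / sqrt (f s' ^ 2))).
{ apply (Rmult_eq_reg_r (/ sqrt (f s ^ 2))); [| now apply Rinv_neq_0_compat; lra].
  unfold Rdiv in hc; rewrite hc; field; lra. }
assert (0 < sqrt (f s ^ 2) / sqrt (f s' ^ 2)) by now apply Rdiv_lt_0_compat.
rewrite h; nra.
Qed.

(** * The Frenet equations *)

(** Differentiating the constant products [<t, t>], [<t, n>] and [<n, n>] gives [<t, n> = 0] and the
    components of [n'] on [t] and [n]; the definition of torsion gives the one on [b]. *)
Lemma frenet (a b : Rbar) (alpha : R -> vec) (s : R) :
  in_interval a b s ->
  arclength_curve (in_interval a b) alpha ->
  (forall r, in_interval a b r -> 0 < curvature alpha r) ->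
  ex_derive (curvature alpha) s ->
  let t := tangent alpha in
  let n := normal alpha in
  let k := curvature alpha s in
  dot (t s) (t s) = 1 /\ dot (n s) (n s) = 1 /\ dot (t s) (n s) = 0 /\
  is_vderive t s (vscal k (n s)) /\
  is_vderive n s
    (vadd (vscal (- k) (t s)) (vscal (torsion alpha s) (binormal alpha s))).
Proof.
intros hs halpha hk hdk t n k.
assert (hn1 : forall r, in_interval a b r -> dot (n r) (n r) = 1).
{ intros r hr; specialize (hk r hr).
  unfold n, normal; rewrite dot_scall, dot_scalr.
  assert (h : curvature alpha r * curvature alpha r =
    dot (vderive (tangent alpha) r) (vderive (tangent alpha) r))
    by (apply sqrt_sqrt, dot_nonneg).
  rewrite <- h; field; lra. }
assert (ht1 : forall r, in_interval a b r -> dot (t r) (t r) = 1).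
{ intros r hr; apply vnorm_1, halpha, hr. }
assert (ht : forall r, in_interval a b r ->
  is_vderive t r (vscal (curvature alpha r) (n r))).
{ intros r hr; destruct (halpha r hr) as (_ & h & _); specialize (hk r hr).
  apply vderive_correct in h; apply (is_vderive_eq _ _ _ _ h).
  unfold n, normal; rewrite vscal_mul, Rinv_r, vscal_1 by lra; reflexivity. }
assert (htn : forall r, in_interval a b r -> dot (t r) (n r) = 0).
{ intros r hr.
  assert (h0 : is_derive (fun q => dot (t q) (t q)) r 0).
  { apply (is_derive_local a b (fun _ => 1)); trivial.
    - intros q hq; now rewrite ht1.
    - apply (is_derive_const (K := R_AbsRing) (V := R_NormedModule)). }
  apply is_derive_unique in h0.
  specialize (is_derive_unique _ _ _ (is_derive_dot _ _ _ _ _ (ht r hr) (ht r hr))) as h1.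
  rewrite dot_scalr, dot_scall, (dot_comm (n r)) in h1; specialize (hk r hr).
  assert (curvature alpha r * dot (t r) (n r) = 0) by lra.
  nra. }
(* [n] is [t'] times the reciprocal of the curvature: the third derivative of [alpha] handles one
   factor, [hdk] the other. *)
assert (hdn : exists n', is_vderive n s n').
{ destruct (halpha s hs) as (_ & _ & h & _).
  apply vderive_correct in h.
  eexists; apply is_vderive_scal; [| exact h].
  apply is_derive_inv; [apply Derive_correct, hdk | specialize (hk s hs); lra]. }
destruct hdn as [n' hn'].
split; [| split; [| split; [| split]]]; auto.
apply (is_vderive_eq _ _ _ _ hn').
rewrite (orthonormal_expand (t s) (n s) n') by auto.
assert (h1 : dot n' (t s) = - k).
{ assert (h0 : is_derive (fun q => dot (t q) (n q)) s 0).
  { apply (is_derive_local a b (fun _ => 0)); trivial.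
    - intros q hq; now rewrite htn.
    - apply (is_derive_const (K := R_AbsRing) (V := R_NormedModule)). }
  apply is_derive_unique in h0.
  specialize (is_derive_unique _ _ _ (is_derive_dot _ _ _ _ _ (ht s hs) hn')) as h1.
  rewrite dot_scall, hn1, (dot_comm (t s)) in h1 by trivial; unfold k; lra. }
assert (h2 : dot n' (n s) = 0).
{ assert (h0 : is_derive (fun q => dot (n q) (n q)) s 0).
  { apply (is_derive_local a b (fun _ => 1)); trivial.
    - intros q hq; now rewrite hn1.
    - apply (is_derive_const (K := R_AbsRing) (V := R_NormedModule)). }
  apply is_derive_unique in h0.
  specialize (is_derive_unique _ _ _ (is_derive_dot _ _ _ _ _ hn' hn')) as h1'.
  rewrite (dot_comm (n s)) in h1'; lra. }
(* Here [b' = t' x n + t x n'], and the first term vanishes because [t'] is a multiple of [n]; so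
   [- <b', n>] is the triple product on the left. *)
assert (h3 : dot n' (cross (t s) (n s)) = torsion alpha s).
{ unfold torsion.
  specialize (is_vderive_unique _ _ _ (is_vderive_cross _ _ _ _ _ (ht s hs) hn')) as h.
  change (vderive (binormal alpha) s = 
    vadd (cross (vscal (curvature alpha s) (n s)) (n s)) (cross (t s) n')) in h.
  rewrite h; fold n; generalize (t s) (n s); intros; vec_ring. }
rewrite h1, h2, h3.
change (binormal alpha s) with (cross (t s) (n s)).
generalize (t s) (n s) (torsion alpha s); intros; vec_ring.
Qed.

(** * Components of the frame along the axis *)

(** Parseval's identity for [d] in the frame [t], [n], [t x n]. *)
Lemma frame_norm (t n d : vec) (lambda : R) :
  dot t t = 1 -> dot n n = 1 -> dot t n = 0 -> dot d d = 1 ->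
  dot n d = lambda * dot t d ->
  (1 + lambda ^ 2) * dot t d ^ 2 + dot (cross t n) d ^ 2 = 1.
Proof.
intros ht hn htn hd hnd.
assert (hx := f_equal (dot d) (orthonormal_expand t n d ht hn htn)).
rewrite !dot_addr, !dot_scalr, (dot_comm d n), (dot_comm d t),
  (dot_comm d (cross t n)), hd, hnd in hx; lra.
Qed.

(** Along a whirl curve, the left side is, up to the factor [kappa / (1 - u^2)^(3/2)], the
    derivative of the unit vector along [t - u d]. Being a multiple of [d x t], it shows that this
    vector turns about [d]. *)
Lemma frame_axis (t n d : vec) (lambda : R) :
  dot t t = 1 -> dot n n = 1 -> dot t n = 0 -> dot d d = 1 ->
  dot n d = lambda * dot t d ->
  let u := dot t d in
  vadd (vscal (1 - u ^ 2) (vsub n (vscal (lambda * u) d)))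
       (vscal (lambda * u ^ 2) (vsub t (vscal u d))) =
  vscal (dot (cross t n) d) (cross d t).
Proof.
intros ht hn htn hd hnd u.
assert (hN := frame_norm t n d lambda ht hn htn hd hnd).
assert (hx := orthonormal_expand t n d ht hn htn).
rewrite (dot_comm d n), (dot_comm d t), (dot_comm d (cross t n)), hnd in hx.
fold u in hx, hN.
set (w := dot (cross t n) d) in *.
assert (hc : cross d t = vsub (vscal w n) (vscal (lambda * u) (cross t n))).
{ rewrite hx.
  (* With [b = t x n], the product [b x t] is a double cross product, expanded as
     [<t, t> n - <t, n> t]. *)
  transitivity (vsub (vscal w (vsub (vscal (dot t t) n) (vscal (dot t n) t)))
     (vscal (lambda * u) (cross t n))).
  - clearbody u w; clear; vec_ring.
  - rewrite ht, htn; clearbody u w; clear; vec_ring. }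
rewrite hc, hx.
replace (1 - u ^ 2) with (w ^ 2 + lambda ^ 2 * u ^ 2) by lra.
generalize (cross t n); intros b.
clearbody u w; clear - hN.
(* The two sides differ by a multiple of [1 - ((1 + lambda^2) u^2 + w^2)], which [hN] makes zero. *)
transitivity (vadd (vscal w (vsub (vscal w n) (vscal (lambda * u) b)))
  (vscal ((1 - ((1 + lambda ^ 2) * u ^ 2 + w ^ 2)) * (lambda * u))
     (vadd (vadd (vscal u t) (vscal (lambda * u) n)) (vscal w b)))).
- clear hN; vec_ring.
- rewrite hN; clear hN; vec_ring.
Qed.

(** * Rigid motions and orthonormal frames *)

Definition frame_map (o e1 e2 e3 v : vec) : vec :=
  vadd o (vadd (vscal (vx v) e1) (vadd (vscal (vy v) e2) (vscal (vz v) e3))).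

(** Squared distances expand in the Gram matrix of the frame, which is the identity. The frame has
    determinant [|e|^2 |d|^2 - <e, d>^2 = 1], and determinants multiply, so orientation is kept. *)
Lemma frame_map_rigid (o e d : vec) :
  dot e e = 1 -> dot d d = 1 -> dot e d = 0 ->
  rigid_motion (frame_map o e (cross d e) d).
Proof.
intros he hd hed.
assert (hc : dot (cross d e) (cross d e) = 1)
  by (rewrite dot_cross_self, he, hd, (dot_comm d e), hed; ring).
assert (hce := dot_cross_r d e); assert (hcd := dot_cross_l d e).
split.
- intros p q; apply vnorm_eq.
  generalize dependent (cross d e); intros c hc hce hcd.
  transitivity ((vx p - vx q) ^ 2 * dot e e + (vy p - vy q) ^ 2 * dot c c +
    (vz p - vz q) ^ 2 * dot d d + 2 * (vx p - vx q) * (vy p - vy q) * dot c e +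
    2 * (vx p - vx q) * (vz p - vz q) * dot e d +
    2 * (vy p - vy q) * (vz p - vz q) * dot c d).
  + unfold frame_map; clear; vec_ring.
  + rewrite he, hd, hed, hc, hce, hcd; clear; vec_ring.
- intros p u v w h.
  assert (ht : triple e (cross d e) d = 1).
  { transitivity (dot e e * dot d d - dot e d ^ 2); [clear; vec_ring |].
    rewrite he, hd, hed; ring. }
  generalize dependent (cross d e); intros c hc hce hcd ht.
  replace (triple _ _ _) with (triple u v w * triple e c d).
  + rewrite ht; lra.
  + unfold frame_map; clear; vec_ring.
Qed.

(** Polarization of the three distances among [p], the origin and [(0, 0, 1)]. It lets the converse
    read off a third coordinate after the motion. *)
Lemma isometry_dot (f : vec -> vec) (p : vec) :
  isometry f ->
  dot (vsub (f p) (f (0, 0, 0))) (vsub (f (0, 0, 1)) (f (0, 0, 0))) = vz p.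
Proof.
intros hf.
assert (h : forall p q, dot (vsub (f p) (f q)) (vsub (f p) (f q)) =
                        dot (vsub p q) (vsub p q))
  by (intros; apply vnorm_eq, hf).
assert (h1 := h p (0, 0, 0)); assert (h2 := h (0, 0, 1) (0, 0, 0));
assert (h3 := h p (0, 0, 1)).
clear h; revert h1 h2 h3; generalize (f p) (f (0, 0, 0)) (f (0, 0, 1)).
clear; intros u v w h1 h2 h3.
destruct p as [[? ?] ?], u as [[? ?] ?], v as [[? ?] ?], w as [[? ?] ?].
unfold dot, vsub, vx, vy, vz in *; simpl in *; lra.
Qed.

(** * Rotation about the axis and the angle function *)

Lemma is_derive_Rcomp (f g : R -> R) (s df dg : R) :
  is_derive f (g s) df -> is_derive g s dg ->
  is_derive (fun r => f (g r)) s (dg * df).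
Proof. intros hf hg; apply (is_derive_comp f g s df dg hf hg). Qed.

(** [H] turns about [d] with angular velocity [psi']; rotating it back through [psi] freezes it,
    because [d x (d x H) = - H] in the plane orthogonal to [d]. *)
Lemma rotating_frame (H : R -> vec) (psi : R -> R) (d : vec) (s omega : R) :
  dot d d = 1 -> dot (H s) d = 0 ->
  is_vderive H s (vscal omega (cross d (H s))) -> is_derive psi s omega ->
  is_vderive (fun r => vsub (vscal (cos (psi r)) (H r))
                            (vscal (sin (psi r)) (cross d (H r)))) s (0, 0, 0).
Proof.
intros hd hHd hH hpsi.
eapply is_vderive_eq.
- apply is_vderive_sub; apply is_vderive_scal.
  + apply is_derive_Rcomp; [apply is_derive_cos | exact hpsi].
  + exact hH.
  + apply is_derive_Rcomp; [apply is_derive_sin | exact hpsi].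
  + apply is_vderive_cross; [apply is_vderive_const | exact hH].
- assert (h : vadd (vscal (dot d d) (H s)) (cross d (cross d (H s))) =
    vscal (dot (H s) d) d) by (generalize (H s); clear; intros; vec_ring).
  rewrite hd, hHd, vscal_1 in h.
  (* The terms in [cos (psi s)] cancel, and [h] says that the remaining bracket is zero. *)
  transitivity (vscal (- sin (psi s) * omega)
    (vadd (H s) (cross d (cross d (H s))))).
  + generalize (H s) (sin (psi s)) (cos (psi s)); clear; intros; vec_ring.
  + rewrite h; clear; vec_ring.
Qed.

(** This is [whirl_angle] in the variable [w = sqrt (1 - E^2)], not half of an angle. *)
Definition half_angle (lambda w : R) : R := atan (w / lambda) - arctanh w / lambda.

Lemma is_derive_half_angle (lambda w : R) :
  lambda <> 0 -> 0 < w < 1 ->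
  is_derive (half_angle lambda) w
    (lambda / (lambda ^ 2 + w ^ 2) - / (lambda * (1 - w ^ 2))).
Proof.
intros hl hw; unfold half_angle, arctanh.
assert (hl2 : 0 < lambda ^ 2) by nra.
auto_derive.
- repeat split; trivial; try lra.
  apply Rmult_lt_0_compat; [lra | apply Rinv_0_lt_compat; lra].
- field; repeat split; nra.
Qed.

Lemma is_derive_inv_sqrt (u : R) :
  u ^ 2 < 1 -> is_derive (fun x => / sqrt (1 - x ^ 2)) u
    (u / sqrt (1 - u ^ 2) ^ 3).
Proof.
intros hu.
assert (h : 0 < sqrt (1 - u ^ 2)) by (apply sqrt_lt_R0; lra).
auto_derive; rewrite !Rmult_1_r; replace (1 + - (u * u)) with (1 - u ^ 2) by ring.
- split; [lra | split; trivial; lra].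
- field; lra.
Qed.

(** * Relations along a whirl curve and the constant frame *)

(** The derivatives are Frenet equations projected on [d]. The last relation equates
    [<n', d> = - kappa u + tau w] with [lambda u' = lambda^2 kappa u]. *)
Lemma whirl_relations (a b : Rbar) (alpha : R -> vec) (d : vec) (lambda s : R) :
  in_interval a b s ->
  arclength_curve (in_interval a b) alpha ->
  (forall r, in_interval a b r -> 0 < curvature alpha r) ->
  ex_derive (curvature alpha) s ->
  dot d d = 1 ->
  (forall r, in_interval a b r ->
     dot (normal alpha r) d = lambda * dot (tangent alpha r) d) ->
  let k := curvature alpha s in
  let tau := torsion alpha s in
  let u := fun r => dot (tangent alpha r) d in
  let w := fun r => dot (binormal alpha r) d in
  is_derive u s (lambda * k * u s) /\ is_derive w s (- tau * lambda * u s) /\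
  (1 + lambda ^ 2) * u s ^ 2 + w s ^ 2 = 1 /\
  (1 + lambda ^ 2) * k * u s = tau * w s.
Proof.
intros hs halpha hk hdk hd hnd k tau u w.
destruct (frenet a b alpha s hs halpha hk hdk) as (htt & hnn & htn & ht & hn).
assert (hnds := hnd s hs).
assert (hu : is_derive u s (lambda * k * u s)).
{ eapply is_derive_eq; [apply is_derive_dot_const; exact ht |].
  rewrite dot_scall, hnds; unfold k, u; ring. }
split; [exact hu |].
split; [| split].
- eapply is_derive_eq;
    [apply is_derive_dot_const, is_vderive_cross; [exact ht | exact hn] |].
  fold k tau; change (binormal alpha s) with (cross (tangent alpha s) (normal alpha s)).
  (* All that survives in [b'] is [tau t x (t x n)], expanded by the vector triple product rule. *)
  transitivity (tau * (dot (tangent alpha s) (normal alpha s) * dot (tangent alpha s) d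
     - dot (tangent alpha s) (tangent alpha s) * dot (normal alpha s) d)).
  + generalize (tangent alpha s) (normal alpha s); clear; intros; vec_ring.
  + rewrite htt, htn, hnds; unfold u; ring.
- now apply frame_norm.
- assert (h1 : is_derive (fun r => dot (normal alpha r) d) s
    (lambda * (lambda * k * u s))).
  { apply (is_derive_local a b (fun r => lambda * u r)); trivial.
    - intros r hr; symmetry; now apply hnd.
    - now apply is_derive_scal. }
  assert (h2 := is_derive_dot_const _ d _ _ hn).
  apply is_derive_unique in h1; apply is_derive_unique in h2.
  rewrite h1, dot_addl, !dot_scall in h2.
  fold k tau in h2; fold (u s) (w s) in h2; lra.
Qed.

(** In the plane orthogonal to [d], with basis [e], [d x e], the projection of [t] has polar
    coordinates [rho] and [psi]. The vector [e] arises by unwinding the direction [H] of that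
    projection through [psi], which makes it constant. *)
Lemma whirl_frame (a b : Rbar) (s0 : R) (alpha : R -> vec) (d : vec) (lambda : R) :
  in_interval a b s0 ->
  arclength_curve (in_interval a b) alpha ->
  (forall r, in_interval a b r -> 0 < curvature alpha r) ->
  (forall r, in_interval a b r -> ex_derive (curvature alpha) r) ->
  lambda <> 0 -> dot d d = 1 ->
  (forall r, in_interval a b r ->
     dot (normal alpha r) d = lambda * dot (tangent alpha r) d) ->
  (forall r, in_interval a b r ->
     dot (tangent alpha r) d <> 0 /\ 0 < dot (binormal alpha r) d) ->
  exists e : vec, dot e e = 1 /\ dot e d = 0 /\
    forall s, in_interval a b s ->
      let rho := sqrt (1 - dot (tangent alpha s) d ^ 2) in
      let psi := half_angle lambda (dot (binormal alpha s) d) in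
      dot (tangent alpha s) e = rho * cos psi /\
      dot (tangent alpha s) (cross d e) = rho * sin psi.
Proof.
intros hs0 halpha hk hdk hl hd hnd huw.
set (t := tangent alpha).
set (u := fun r => dot (t r) d).
set (w := fun r => dot (binormal alpha r) d).
set (H := fun r => vscal (/ sqrt (1 - u r ^ 2)) (vsub (t r) (vscal (u r) d))).
set (psi := fun r => half_angle lambda (w r)).
set (e := fun r => vsub (vscal (cos (psi r)) (H r))
                        (vscal (sin (psi r)) (cross d (H r)))).
assert (hl2 : 0 < lambda ^ 2) by nra.
assert (htt : forall s, in_interval a b s -> dot (t s) (t s) = 1)
  by (intros s hs; apply vnorm_1, halpha, hs).
assert (hrel : forall s, in_interval a b s ->
  (1 + lambda ^ 2) * u s ^ 2 + w s ^ 2 = 1).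
{ intros s hs; now apply (whirl_relations a b alpha d lambda s); auto. }
assert (hu1 : forall s, in_interval a b s -> u s ^ 2 < 1).
{ intros s hs; specialize (hrel s hs); destruct (huw s hs) as [_ h].
  change (0 < w s) in h; nra. }
assert (hrho : forall s, in_interval a b s -> 0 < sqrt (1 - u s ^ 2))
  by (intros s hs; apply sqrt_lt_R0; specialize (hu1 s hs); lra).
assert (hrho2 : forall s, in_interval a b s -> sqrt (1 - u s ^ 2) ^ 2 = 1 - u s ^ 2)
  by (intros s hs; apply pow2_sqrt; specialize (hu1 s hs); lra).
assert (hHd : forall s, dot (H s) d = 0).
{ intros s; unfold H; rewrite dot_scall.
  replace (dot (vsub _ _) d) with (u s - u s * dot d d)
    by (unfold u; generalize (t s); clear; intros; vec_ring).
  rewrite hd; ring. }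
assert (hHH : forall s, in_interval a b s -> dot (H s) (H s) = 1).
{ intros s hs; unfold H; rewrite dot_scall, dot_scalr.
  replace (dot (vsub _ _) _) with (dot (t s) (t s) - 2 * u s ^ 2 + u s ^ 2 * dot d d)
    by (unfold u; generalize (t s); clear; intros; vec_ring).
  rewrite hd, htt by trivial.
  replace (1 - 2 * u s ^ 2 + u s ^ 2 * 1) with (1 - u s ^ 2) by ring.
  specialize (hrho s hs); specialize (hrho2 s hs).
  set (rho := sqrt (1 - u s ^ 2)) in *; rewrite <- hrho2; field; lra. }
assert (hconst : forall s, in_interval a b s -> is_vderive e s (0, 0, 0)).
{ intros s hs.
  destruct (whirl_relations a b alpha d lambda s hs halpha hk (hdk s hs) hd hnd)
    as (hdu & hdw & _ & htau).
  destruct (frenet a b alpha s hs halpha hk (hdk s hs))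
    as (_ & hnn & htn & hdt & _).
  specialize (hrel s hs); specialize (hu1 s hs).
  specialize (hrho s hs); specialize (hrho2 s hs); specialize (htt s hs).
  destruct (huw s hs) as [hu0 hw0].
  fold t in hdt, htt, htn, hu0; fold (u s) in hu0; fold (w s) in hw0.
  fold t in hdu, hdw, htau; fold u w in hdu, hdw; fold (u s) (w s) in hdu, hdw, htau.
  assert (hax := frame_axis (t s) (normal alpha s) d lambda htt hnn htn hd (hnd s hs)).
  cbv zeta in hax; fold (u s) in hax.
  change (dot (cross (t s) (normal alpha s)) d) with (w s) in hax.
  set (rho := sqrt (1 - u s ^ 2)) in *.
  set (k := curvature alpha s) in *.
  (* The angular velocity comes from [frame_axis]: [H' = (k / rho^3) w (d x t)], and
     [d x t = rho (d x H)]. *)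
  apply (rotating_frame H psi d s (k * w s / rho ^ 2)); trivial.
  - eapply is_vderive_eq.
    + apply (is_vderive_scal (fun r => / sqrt (1 - u r ^ 2))
        (fun r => vsub (t r) (vscal (u r) d))).
      * apply (is_derive_Rcomp (fun x => / sqrt (1 - x ^ 2)));
          [apply is_derive_inv_sqrt; exact hu1 | exact hdu].
      * apply is_vderive_sub; [exact hdt |].
        apply is_vderive_scal; [exact hdu | apply is_vderive_const].
    + fold rho.
      transitivity (vscal (k / rho ^ 3)
        (vadd (vscal (rho ^ 2) (vsub (normal alpha s) (vscal (lambda * u s) d)))
           (vscal (lambda * u s ^ 2) (vsub (t s) (vscal (u s) d))))).
      * generalize (t s) (normal alpha s) (u s); clearbody rho k; clear - hrho.
        intros [[? ?] ?] [[? ?] ?] v; destruct d as [[? ?] ?].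
        apply vec_ext; unfold vadd, vsub, vscal, vx, vy, vz; simpl; field; lra.
      * rewrite <- hrho2 in hax; rewrite hax; unfold H; fold rho.
        generalize (t s) (u s) (w s); clearbody rho k; clear - hrho.
        intros [[? ?] ?] v ?; destruct d as [[? ?] ?].
        apply vec_ext; unfold cross, vadd, vsub, vscal, vx, vy, vz; simpl; field; lra.
  (* Since [u s] is nonzero, the norm relation keeps [w s] inside the domain of [arctanh]. *)
  - assert (hw1 : w s < 1) by nra.
    eapply is_derive_eq.
    + apply (is_derive_Rcomp (half_angle lambda));
        [apply is_derive_half_angle; trivial; split; assumption | exact hdw].
    (* The norm relation rewrites both denominators of the derivative of [half_angle], and the
       torsion relation eliminates [k]; replacing [w^2] by [rho^2 - lambda^2 u^2] leaves a rational
       identity. *)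
    + assert (hA : lambda ^ 2 + w s ^ 2 = (1 + lambda ^ 2) * rho ^ 2)
        by (rewrite hrho2; lra).
      assert (hB : 1 - w s ^ 2 = (1 + lambda ^ 2) * u s ^ 2) by lra.
      assert (hk' : k = torsion alpha s * w s / ((1 + lambda ^ 2) * u s)).
      { rewrite <- htau; field; split; [exact hu0 | nra]. }
      assert (hw2 : w s ^ 2 = rho ^ 2 - lambda ^ 2 * u s ^ 2) by (rewrite hrho2; lra).
      rewrite hA, hB, hk'.
      replace (torsion alpha s * w s / ((1 + lambda ^ 2) * u s) * w s / rho ^ 2)
        with (torsion alpha s * w s ^ 2 / ((1 + lambda ^ 2) * u s) / rho ^ 2)
        by (field; repeat split; nra).
      rewrite hw2; field; repeat split; nra. }
assert (he : forall s, in_interval a b s -> e s0 = e s)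
  by (intros s hs; now apply (vderive_zero_const a b)).
exists (e s0).
assert (htH : forall s, in_interval a b s ->
  t s = vadd (vscal (u s) d) (vscal (sqrt (1 - u s ^ 2)) (H s))).
{ intros s hs; unfold H; rewrite vscal_mul, Rinv_r, vscal_1
    by (specialize (hrho s hs); lra).
  generalize (t s) (u s); clear; intros; vec_ring. }
assert (hG : forall s, in_interval a b s -> dot (cross d (H s)) (cross d (H s)) = 1).
{ intros s hs; rewrite dot_cross_self, hd, hHH, (dot_comm d), hHd by trivial; ring. }
split; [| split].
- unfold e.
  transitivity (cos (psi s0) ^ 2 * dot (H s0) (H s0) +
    sin (psi s0) ^ 2 * dot (cross d (H s0)) (cross d (H s0))).
  + generalize (H s0) (cos (psi s0)) (sin (psi s0)); clear; intros; vec_ring.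
  + rewrite hHH, hG by trivial; assert (h := sin2_cos2 (psi s0)); unfold Rsqr in h; lra.
- unfold e.
  transitivity (cos (psi s0) * dot (H s0) d).
  + generalize (H s0) (cos (psi s0)) (sin (psi s0)); clear; intros; vec_ring.
  + rewrite hHd; ring.
(* As [e] is constant, both products can be computed at [s] itself, where [t = u d + rho H] and [e]
   is a combination of [H] and [d x H]. *)
- intros s hs rho psi_s; rewrite (he s hs); fold t; rewrite (htH s hs).
  change psi_s with (psi s); change rho with (sqrt (1 - u s ^ 2)); unfold e.
  specialize (hHd s); specialize (hHH s hs).
  revert hHd hHH.
  generalize (H s) (cos (psi s)) (sin (psi s)) (u s) (sqrt (1 - u s ^ 2)).
  clear - hd; intros h c z v r hh1 hh2; split.
  + transitivity (v * c * dot h d + r * c * dot h h); [vec_ring |].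
    rewrite hh1, hh2; ring.
  + transitivity (r * z * (dot h h * dot d d - dot h d ^ 2)); [vec_ring |].
    rewrite hh1, hh2, hd; ring.
Qed.

(** * The curvature integral and the function [E] *)

Lemma is_derive_RInt_C1 (a b : Rbar) (k : R -> R) (s0 s : R) :
  in_interval a b s0 -> in_interval a b s -> C1_on (in_interval a b) k ->
  is_derive (RInt k s0) s (k s).
Proof.
intros hs0 hs hk.
assert (hc : forall r, in_interval a b r -> continuous k r)
  by (intros r hr; apply (ex_derive_continuous (K := R_AbsRing) (V := R_NormedModule)), hk, hr).
apply (is_derive_RInt k _ s0 s); [| now apply hc].
apply (filter_imp (in_interval a b)); [| now apply in_interval_locally].
intros r hr; apply (RInt_correct (V := R_CompleteNormedModule)).
apply (ex_RInt_continuous (V := R_CompleteNormedModule)); intros q hq; apply hc.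
unfold Rmin, Rmax in hq; destruct (Rle_dec s0 r).
- now apply (in_interval_between a b s0 r).
- now apply (in_interval_between a b r s0).
Qed.

(** This is the linear equation [y' = lambda kappa y] that [<t, d>] also satisfies, which makes the
    two proportional. *)
Lemma is_derive_whirl_E (k : R -> R) (s0 lambda B s : R) :
  is_derive (RInt k s0) s (k s) ->
  is_derive (whirl_E k s0 lambda B) s (lambda * k s * whirl_E k s0 lambda B s).
Proof.
intros h; unfold whirl_E.
apply (is_derive_Rcomp exp); [apply is_derive_exp |].
eapply is_derive_eq.
- apply is_derive_Rminus; [apply is_derive_scal, h |].
  apply (is_derive_const (K := R_AbsRing) (V := R_NormedModule)).
- apply Rminus_0_r.
Qed.

(** * Orientation of the axis *)

(** If [u] vanished, [tau w = 0] would force [w = 0], against the norm relation; hence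
    [(1 + lambda^2) kappa u = tau w] keeps [w] nonzero too. So [w] has one sign, and passing to
    [- d] if necessary makes it positive with the same [lambda]. *)
Lemma whirl_axis_oriented (a b : Rbar) (s0 : R) (alpha : R -> vec) (d : vec) (lambda : R) :
  in_interval a b s0 ->
  arclength_curve (in_interval a b) alpha ->
  (forall r, in_interval a b r -> 0 < curvature alpha r) ->
  (forall r, in_interval a b r -> torsion alpha r <> 0) ->
  (forall r, in_interval a b r -> ex_derive (curvature alpha) r) ->
  dot d d = 1 ->
  (forall r, in_interval a b r ->
     dot (normal alpha r) d = lambda * dot (tangent alpha r) d) ->
  exists d' : vec, dot d' d' = 1 /\
    (forall r, in_interval a b r ->
       dot (normal alpha r) d' = lambda * dot (tangent alpha r) d') /\
    (forall r, in_interval a b r ->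
       dot (tangent alpha r) d' <> 0 /\ 0 < dot (binormal alpha r) d').
Proof.
intros hs0 halpha hk ht hdk hd hnd.
assert (huw : forall r, in_interval a b r ->
  dot (tangent alpha r) d <> 0 /\ dot (binormal alpha r) d <> 0 /\
  ex_derive (fun q => dot (binormal alpha q) d) r).
{ intros r hr.
  destruct (whirl_relations a b alpha d lambda r hr halpha hk (hdk r hr) hd hnd)
    as (_ & hw & hN & hR).
  specialize (hk r hr); specialize (ht r hr).
  assert (hl : 0 < 1 + lambda ^ 2) by nra.
  assert (hu : dot (tangent alpha r) d <> 0).
  { intros h0; rewrite h0 in hN, hR.
    assert (h1 : dot (binormal alpha r) d = 0).
    { apply (Rmult_eq_reg_l (torsion alpha r)); [lra | exact ht]. }
    rewrite h1 in hN; lra. }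
  split; [exact hu | split; [| eexists; exact hw]].
  intros h0; rewrite h0, Rmult_0_r in hR.
  apply Rmult_integral in hR; destruct hR as [hR | hR]; [| exact (hu hR)].
  apply Rmult_integral in hR; lra. }
assert (hw : forall r, in_interval a b r ->
  0 < dot (binormal alpha s0) d * dot (binormal alpha r) d).
{ intros r hr.
  apply (nonvanishing_same_sign a b (fun q => dot (binormal alpha q) d)); trivial.
  intros q hq; destruct (huw q hq) as (_ & h1 & h2); split; trivial. }
set (c := if Rlt_dec 0 (dot (binormal alpha s0) d) then 1 else -1).
assert (hc : c ^ 2 = 1) by (unfold c; destruct Rlt_dec; ring).
assert (hcw : 0 < c * dot (binormal alpha s0) d).
{ destruct (huw s0 hs0) as (_ & h & _); unfold c; destruct Rlt_dec; lra. }
exists (vscal c d); split; [| split].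
- rewrite dot_scall, dot_scalr, hd; lra.
- intros r hr; rewrite !dot_scalr, hnd by trivial; ring.
- intros r hr; rewrite !dot_scalr.
  destruct (huw r hr) as (hu & _); specialize (hw r hr); split.
  + apply Rmult_integral_contrapositive_currified; [nra | exact hu].
  + unfold c in *; destruct Rlt_dec; nra.
Qed.

Lemma vsub_0_r (v : vec) : vsub v (0, 0, 0) = v.
Proof. vec_ring. Qed.

(** * Whirl curves and their position vectors *)

Theorem theorem2p4 (a b : Rbar) (s0 : R) (alpha : R -> vec)
    (hs0 : in_interval a b s0)
    (halpha : arclength_curve (in_interval a b) alpha)
    (hkappa : forall s : R, in_interval a b s -> 0 < curvature alpha s)
    (htau : forall s : R, in_interval a b s -> torsion alpha s <> 0)
    (hkappaC1 : C1_on (in_interval a b) (curvature alpha))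
    (htauC1 : C1_on (in_interval a b) (torsion alpha)) :
  whirl_curve (in_interval a b) alpha <->
  exists lambda B : R,
    lambda <> 0 /\
    (forall s : R, in_interval a b s ->
       lambda * RInt (curvature alpha) s0 s < B) /\
    let E := whirl_E (curvature alpha) s0 lambda B in
    exists (x y z : R -> R) (eps : R) (f : vec -> vec),
      antiderivative_on (in_interval a b)
        (fun s => whirl_speed lambda (E s) * cos (whirl_angle lambda (E s))) x /\
      antiderivative_on (in_interval a b)
        (fun s => whirl_speed lambda (E s) * sin (whirl_angle lambda (E s))) y /\
      antiderivative_on (in_interval a b)
        (fun s => E s / sqrt (1 + lambda ^ 2)) z /\
      (eps = 1 \/ eps = -1) /\
      rigid_motion f /\
      forall s : R, in_interval a b s ->
        alpha s = f (x s, y s, eps * z s).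
Proof.
assert (hdk : forall r, in_interval a b r -> ex_derive (curvature alpha) r)
  by (intros r hr; apply hkappaC1, hr).
assert (hK : forall s, in_interval a b s ->
  is_derive (RInt (curvature alpha) s0) s (curvature alpha s))
  by (intros s hs; now apply (is_derive_RInt_C1 a b)).
assert (hdalpha : forall s, in_interval a b s -> is_vderive alpha s (tangent alpha s))
  by (intros s hs; apply vderive_correct, halpha, hs).
split.
- intros (_ & _ & _ & d0 & lambda & hd0 & hl & hnd0).
  apply vnorm_1 in hd0.
  destruct (whirl_axis_oriented a b s0 alpha d0 lambda) as (d & hd & hnd & huw); trivial.
  destruct (whirl_frame a b s0 alpha d lambda) as (e & he & hed & hframe); trivial.
  set (u := fun r => dot (tangent alpha r) d).
  assert (hrel : forall s, in_interval a b s ->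
    is_derive u s (lambda * curvature alpha s * u s) /\
    (1 + lambda ^ 2) * u s ^ 2 + dot (binormal alpha s) d ^ 2 = 1).
  { intros s hs.
    destruct (whirl_relations a b alpha d lambda s) as (h1 & _ & h2 & _); auto. }
  set (q := sqrt (1 + lambda ^ 2)).
  assert (hq : 0 < q) by (apply sqrt_lt_R0; nra).
  assert (hq2 : q ^ 2 = 1 + lambda ^ 2) by (apply pow2_sqrt; nra).
  (* [E] is positive while [u] may be negative; the sign of [u] at [s0] becomes the sign of the
     third coordinate. *)
  set (eps := if Rlt_dec 0 (u s0) then 1 else -1).
  assert (heps : eps = 1 \/ eps = -1) by (unfold eps; destruct Rlt_dec; auto).
  assert (heps2 : eps * eps = 1) by (destruct heps as [-> | ->]; ring).
  set (c := eps * u s0 * q).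
  assert (hc : 0 < c).
  { apply Rmult_lt_0_compat; [| exact hq]; destruct (huw s0 hs0) as [h _].
    change (u s0 <> 0) in h; unfold eps; destruct Rlt_dec; lra. }
  (* [B] is chosen so that [E s0 = exp (- B) = c], where [c] is [|u s0| sqrt (1 + lambda^2)]. *)
  exists lambda, (- ln c).
  set (E := whirl_E (curvature alpha) s0 lambda (- ln c)).
  assert (hE : forall s, in_interval a b s -> E s = eps * u s * q).
  { intros s hs.
    assert (hE0 : E s0 = c).
    { unfold E, whirl_E; rewrite RInt_point; unfold zero; simpl.
      rewrite Rmult_0_r, Rminus_0_l, Ropp_involutive; now apply exp_ln. }
    assert (hpos : forall r, 0 < E r) by (intros r; apply exp_pos).
    assert (h : u s / E s = u s0 / E s0).
    { apply (derive_zero_const a b (fun r => u r / E r)); trivial.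
      intros r hr; eapply is_derive_eq.
      - apply (is_derive_div u E r); [apply hrel, hr |
          apply is_derive_whirl_E, hK, hr | specialize (hpos r); lra].
      - fold E; specialize (hpos r); field; lra. }
    rewrite hE0 in h; specialize (hpos s).
    assert (hu : u s = u s0 / c * E s) by (rewrite <- h; field; lra).
    rewrite hu; unfold c; field; repeat split; try lra.
    now apply huw. }
  assert (hE2 : forall s, in_interval a b s -> E s ^ 2 = (1 + lambda ^ 2) * u s ^ 2).
  { intros s hs; rewrite hE by trivial; rewrite <- hq2.
    transitivity ((eps * eps) * (q ^ 2 * u s ^ 2)); [ring | rewrite heps2; ring]. }
  assert (hw : forall s, in_interval a b s ->
    sqrt (1 - E s ^ 2) = dot (binormal alpha s) d).
  { intros s hs; destruct (hrel s hs) as [_ h]; destruct (huw s hs) as [_ hw0].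
    rewrite hE2 by trivial.
    replace (1 - _) with (dot (binormal alpha s) d ^ 2) by lra.
    apply sqrt_pow2; lra. }
  assert (hangle : forall s, in_interval a b s ->
    whirl_angle lambda (E s) = half_angle lambda (dot (binormal alpha s) d)).
  { intros s hs; unfold whirl_angle; now rewrite hw. }
  assert (hspeed : forall s, in_interval a b s ->
    whirl_speed lambda (E s) = sqrt (1 - u s ^ 2)).
  { intros s hs; unfold whirl_speed; rewrite hE2 by trivial; f_equal; field; nra. }
  split; [exact hl | split].
  + intros s hs.
    (* The bound by [B] says that the exponent of [E] is negative, that is [E < 1]; this follows
       from [E^2 = 1 - w^2] with [w > 0]. *)
    assert (h : E s < exp 0).
    { rewrite exp_0; destruct (hrel s hs) as [_ h]; destruct (huw s hs) as [_ hw0].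
      specialize (hE2 s hs); nra. }
    apply exp_lt_inv in h; lra.
  (* These are the coordinates of [alpha] in the frame [e], [d x e], [d]; the factor [eps] in the
     third makes its derivative positive and is undone by the [eps] of the statement. *)
  + exists (fun s => dot (alpha s) e), (fun s => dot (alpha s) (cross d e)),
      (fun s => eps * dot (alpha s) d), eps, (frame_map (0, 0, 0) e (cross d e) d).
    split; [| split; [| split; [| split; [exact heps | split]]]].
    * intros s hs; rewrite hspeed, hangle by trivial.
      eapply is_derive_eq;
        [apply is_derive_dot_const, hdalpha, hs | apply (hframe s hs)].
    * intros s hs; rewrite hspeed, hangle by trivial.
      eapply is_derive_eq;
        [apply is_derive_dot_const, hdalpha, hs | apply (hframe s hs)].
    * intros s hs; rewrite hE by trivial.
      eapply is_derive_eq;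
        [apply is_derive_scal, is_derive_dot_const, hdalpha, hs |].
      fold (u s); fold q; field; lra.
    * now apply frame_map_rigid.
    * intros s _.
      assert (hde : dot d e = 0) by now rewrite dot_comm.
      rewrite (orthonormal_expand d e (alpha s) hd he hde) at 1.
      unfold frame_map.
      replace (vz _) with (eps * eps * dot (alpha s) d) by (unfold vz; simpl; ring).
      rewrite heps2; generalize (alpha s); clear; intros; vec_ring.
- intros (lambda & B & hl & _ & hex); cbv zeta in hex.
  destruct hex as (x & y & z & eps & f & _ & _ & hz & heps & [hf _] & hpos).
  repeat split; trivial; try apply halpha; trivial.
  set (E := whirl_E (curvature alpha) s0 lambda B) in *.
  set (d := vsub (f (0, 0, 1)) (f (0, 0, 0))).
  exists d, lambda.
  (* By [isometry_dot], [<alpha - f (0, 0, 0), d>] is the third coordinate [eps z]; differentiating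
     it in both forms gives [<t, d>]. *)
  assert (hu : forall s, in_interval a b s ->
    dot (tangent alpha s) d = eps * (E s / sqrt (1 + lambda ^ 2))).
  { intros s hs.
    assert (h1 : is_derive (fun r => dot (vsub (alpha r) (f (0, 0, 0))) d) s
      (eps * (E s / sqrt (1 + lambda ^ 2)))).
    { apply (is_derive_local a b (fun r => eps * z r)); trivial.
      - intros r hr; rewrite (hpos r hr); unfold d; now rewrite isometry_dot.
      - now apply is_derive_scal, hz. }
    apply is_derive_unique in h1; rewrite <- h1; symmetry; apply is_derive_unique.
    eapply is_derive_eq.
    - apply is_derive_dot_const, is_vderive_sub; [apply hdalpha, hs |].
      apply is_vderive_const.
    - now rewrite vsub_0_r. }
  split; [| split; [exact hl |]].
  + apply vnorm_1; unfold d; now rewrite isometry_dot.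
  + intros s hs.
    destruct (frenet a b alpha s hs halpha hkappa (hdk s hs)) as (_ & _ & _ & ht & _).
    (* A second differentiation gives [kappa <n, d>] on one side and [lambda kappa <t, d>] on the
       other, and [kappa] cancels. *)
    assert (h1 : is_derive (fun r => dot (tangent alpha r) d) s
      (eps * (lambda * curvature alpha s * E s * / sqrt (1 + lambda ^ 2)))).
    { apply (is_derive_local a b (fun r => eps * (E r / sqrt (1 + lambda ^ 2)))); trivial.
      - intros r hr; symmetry; now apply hu.
      - apply is_derive_scal.
        eapply is_derive_eq; [apply is_derive_Rmult;
          [apply is_derive_whirl_E, hK, hs |
           apply (is_derive_const (K := R_AbsRing) (V := R_NormedModule))] |].
        fold E; unfold zero; simpl; ring. }
    apply is_derive_unique in h1.
    assert (h2 := is_derive_unique _ _ _ (is_derive_dot_const _ d _ _ ht)).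
    rewrite h1, dot_scall in h2.
    apply (Rmult_eq_reg_l (curvature alpha s)); [| specialize (hkappa s hs); lra].
    rewrite <- h2, hu by trivial; unfold Rdiv; ring.
Qed.
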